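(* For every $\lambda\in\mathbb{N}$, $$\dim\Big\{x\in[0,1)\setminus\mathbb{Q}:\ \text{for all } n\in\mathbb{N} \text{ and all } \mu\in\mathbb{N}\setminus\{\lambda\},\ L_n(x,\lambda)>L_n(x,\mu)\Big\}=1.$$
   Context: $\mathbb{N}=\{1,2,3,\dots\}$, and $\dim$ denotes Hausdorff dimension. Every $x\in[0,1)\setminus\mathbb{Q}$ has a unique continued fraction expansion $x=[a_1,a_2,a_3,\dots]=\cfrac{1}{a_1+\cfrac{1}{a_2+\cfrac{1}{a_3+\cdots}}}$ with partial quotients $a_n=a_n(x)\in\mathbb{N}$. For $n\in\mathbb{N}$, $x\in[0,1)\setminus\mathbb{Q}$ and $\lambda\in\mathbb{N}$, the fixed-symbol longest-run function is $L_n(x,\lambda)=\max_{0\le j\le n-1}\sum_{k=1}^{n-j}\prod_{i=1}^{k}\mathbf{1}_{a_{j+i}(x)=\lambda}\in\mathbb{N}\cup\{0\}$; equivalently, $L_n(x,\lambda)$ is the maximum length of a consecutive run of the value $\lambda$ among the first $n$ partial quotients $a_1(x),\dots,a_n(x)$ (equal to $0$ if $\lambda$ does not occur). *)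

(* Defs.v *)
From mathcomp Require Import all_boot all_order all_algebra.
From mathcomp Require Import all_classical all_reals all_analysis.

Set Implicit Arguments.
Unset Strict Implicit.
Unset Printing Implicit Defensive.

Import Order.TTheory GRing.Theory Num.Theory.
Import numFieldNormedType.Exports.

Local Open Scope classical_set_scope.
Local Open Scope ring_scope.

Section hausdorff.
Context {R : realType}.
Implicit Types (A U : set R) (s delta : R).

(* [diam set0] is -oo, the supremum of the empty set. *)
Definition diam U : \bar R :=
  ereal_sup [set `|p.1 - p.2|%:E | p in U `*` U].

(* [diam U] to the power [s], with the usual conventions for s = 0: the empty
   set contributes 0, while a singleton contributes 0 ^ 0 = 1. *)
Definition diam_pow s U : \bar R :=
  if U == set0 then 0%E else (diam U `^ s)%E.

(* Finite covers are included, since the sets of a cover may be empty. *)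
Definition delta_cover delta A : set (set R)^nat :=
  [set U | (forall k, (diam (U k) <= delta%:E)%E) /\ A `<=` \bigcup_k U k].

Definition hausdorff_premeasure s delta A : \bar R :=
  ereal_inf [set (\sum_(0 <= k <oo) diam_pow s (U k))%E
            | U in delta_cover delta A].

(* [hausdorff_premeasure s delta A] grows as delta decreases, so this supremum
   is its limit as delta tends to 0 from the right. *)
Definition hausdorff_measure s A : \bar R :=
  ereal_sup [set hausdorff_premeasure s delta A | delta in [set d | 0 < d]].

Definition hausdorff_dim A : \bar R :=
  ereal_inf [set s%:E | s in [set s | 0 <= s /\ hausdorff_measure s A = 0%E]].

End hausdorff.

Section continued_fraction.
Context {R : realType}.
Implicit Types (x : R) (a : nat^nat) (n lambda : nat).

(* 1 / (c_1 + 1 / (c_2 + ... + 1 / c_m)) for c = [:: c_1; ...; c_m] *)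
Definition cf_value (c : seq nat) : R :=
  foldr (fun b y => (b%:R + y)^-1) 0 c.

(* x = [a 0, a 1, a 2, ...], the infinite continued fraction being the limit
   of its truncations; here sequences are indexed from 0. *)
Definition cf_expansion x a : Prop :=
  (forall n, (0 < a n)%N) /\ cf_value (mkseq a n) @[n --> \oo] --> x.

(* The n-th partial quotient, indexed from n = 1. The expansion exists and is
   unique when x is an irrational of [0, 1); otherwise the value is
   irrelevant. *)
Definition partial_quotient x n : nat :=
  (get [set a | cf_expansion x a] : nat^nat) n.-1.

Definition longest_run n x lambda : nat :=
  (\max_(0 <= j < n) \sum_(1 <= k < (n - j).+1)
      \prod_(1 <= i < k.+1) (partial_quotient x (j + i) == lambda))%N.

End continued_fraction.

(* Main.v *)
Require Import Defs.
From mathcomp Require Import all_boot all_order all_algebra.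
From mathcomp Require Import all_classical all_reals all_analysis.
From mathcomp Require Import zify ring lra.

Import Order.TTheory GRing.Theory Num.Theory.
Import numFieldNormedType.Exports.

Local Open Scope classical_set_scope.
Local Open Scope ring_scope.

(** Fix n and put K = n + 1. If the first K partial quotients of x equal lambda,
    and so does every partial quotient whose rank from 0 is a multiple of K, then
    runs of any other symbol have length at most n, and none of them starts
    before the initial run of K symbols lambda is complete: lambda strictly
    dominates at every time, [longest_run_lt]. The other partial quotients are
    free, so the expansion is lambda^K followed by an arbitrary concatenation of
    blocks lambda w with w a word of length n. The frequency 1 / K of imposed
    symbols tends to 0, which is why these sets reach dimension 1 in the limit.

    To bound the dimension below by s < 1, let t |-> [w; t] be the branch of the
    continued fraction map attached to w, and |w| the length of its image. It is
    a Moebius map with bounded distortion, so it multiplies distances by a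
    factor between |w| / 2 and 2 |w|, [cf_map_dist_ge] and [cf_map_dist_le].
    Three facts combine:
    - the cylinders of words of length n over a large finite alphabet fill half
      of [0, 1], [words_fill], while each has length at most 2^-n, [cf_len_le];
    - hence for s < 1, some r admits many words with |w| >= r, namely at least
      C r^-s of them, for a constant C that can be prescribed if n is large: if
      every dyadic r failed, summing over r = 2^-j with j >= n would bound the
      total length by a small geometric tail, [dyadic_pigeonhole];
    - the lower Lipschitz constants of branches multiply under composition, so
      the m selected blocks, each with constant rho and m rho^s >= 1, give
      expansions that are rho^k apart, up to a constant, when they first differ
      in block k, [cf_blocks_sep].

    Using the base m digits of y in [0, 1) as block numbers defines an x = g(y)
    in the set with |y - y'| <= C |g(y) - g(y')|^s, because y and y' with the
    same k first digits are at distance at most m^-k <= (rho^k)^s. A cover of the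
    set thus pulls back to a cover of [0, 1), and countable subadditivity of
    Lebesgue measure keeps the s-dimensional measure away from 0,
    [hausdorff_measure_neq0_of_holder]. The dimension is at most 1 because the
    set lies in [0, 1), [hausdorff_measure_unit_itv]. *)

(** * Cylinders and bounded distortion *)

Section cylinders.
Context {R : realType}.
Implicit Types (w : seq nat) (t : R) (b : nat).

(** The inverse branch t |-> [w_1, ..., w_n + t] of the Gauss map. *)
Definition cf_map w t : R := foldr (fun b y => (b%:R + y)^-1) t w.

(** The length of the cylinder of w, as [cf_map w] is monotone. *)
Definition cf_len w : R := `|cf_map w 1 - cf_map w 0|.

Lemma cf_value_map w : cf_value w = cf_map w 0. Proof. by []. Qed.

Lemma cf_map_cat u v t : cf_map (u ++ v) t = cf_map u (cf_map v t).
Proof. exact: foldr_cat. Qed.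

Lemma cf_map_rcons w b t : cf_map (rcons w b) t = cf_map w (b%:R + t)^-1.
Proof. by rewrite -cats1 cf_map_cat. Qed.

Lemma digit_ge1 b : (0 < b)%N -> (1 : R) <= b%:R.
Proof. by move=> b0; rewrite ler1n. Qed.

Lemma inv_itv b t : (0 < b)%N -> 0 <= t -> 0 <= (b%:R + t)^-1 <= 1.
Proof.
move=> /digit_ge1 b1 t0; have bt : 1 <= b%:R + t by lra.
by rewrite invr_ge0 invf_le1 ?bt ?andbT; lra.
Qed.

Lemma cf_map_itv w t : all (leq 1) w -> 0 <= t <= 1 -> 0 <= cf_map w t <= 1.
Proof.
elim: w => //= b w IHw /andP[b0 w0] t01.
by have /andP[? _] := IHw w0 t01; exact: inv_itv.
Qed.

(** Here p / q and p' / q' are the last two convergents of w. Appending b to w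
    replaces (q, q') by (b q + q', q); as b >= 1 this at least doubles
    q (q + q'), the inverse of the cylinder length. *)
Lemma cf_map_moebius w : all (leq 1) w -> exists p p' q q' : R,
  [/\ 0 < q, 0 <= q' <= q, `|p * q' - p' * q| = 1, 2 ^+ size w <= q * (q + q')
    & forall t, 0 <= t -> cf_map w t = (p + t * p') / (q + t * q')].
Proof.
elim/last_ind: w => [_|w b IHw].
  exists 0, 1, 1, 0; split; rewrite ?ler01 ?lexx ?expr0 //=; try lra.
    by rewrite mul0r mul1r sub0r normrN1.
  by move=> t _; rewrite add0r mulr1 mulr0 addr0 divr1.
rewrite all_rcons => /andP[b0 /IHw[p [p' [q [q' [q0 /andP[q'0 q'q] det sz E]]]]]].
have b1 := digit_ge1 b b0.
exists (b%:R * p + p'), p, (b%:R * q + q'), q; split.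
- nra.
- by apply/andP; split; nra.
- by rewrite -det -normrN; congr `|_|; ring.
- rewrite size_rcons exprS; apply: (le_trans (y := 2 * (q * (q + q')))).
    by rewrite ler_pM2l.
  have : q <= b%:R * q by rewrite ler_peMl// ltW.
  set B := b%:R * q => qB; apply: (le_trans (y := (q + q') * (q + q + q'))).
    by nra.
  by apply: ler_pM; lra.
- move=> t t0; rewrite cf_map_rcons E; last by have /andP[] := inv_itv b t b0 t0.
  field; rewrite ?gt_eqF//; nra.
Qed.

(** The unit determinant gives the distance between two values in closed form;
    every estimate below compares its denominator with q (q + q'), up to a
    factor 2 since 0 <= q' <= q. *)
Lemma cf_len_moebius w : all (leq 1) w -> exists q q' : R,
  [/\ 0 < q, 0 <= q' <= q, 2 ^+ size w <= q * (q + q'), cf_len w = (q * (q + q'))^-1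
    & forall t t', 0 <= t -> 0 <= t' -> `|cf_map w t - cf_map w t'| =
        `|t - t'| / ((q + t * q') * (q + t' * q'))].
Proof.
move=> /cf_map_moebius[p [p' [q [q' [q0 /[dup] q'q /andP[q'0 _] det sz E]]]]].
have dist t t' : 0 <= t -> 0 <= t' -> `|cf_map w t - cf_map w t'| =
    `|t - t'| / ((q + t * q') * (q + t' * q')).
  move=> t0 t'0.
  have ? : 0 < q + t * q' by rewrite ltr_pwDl// mulr_ge0.
  have ? : 0 < q + t' * q' by rewrite ltr_pwDl// mulr_ge0.
  rewrite !E// (_ : _ - _ = (p' * q - p * q') * (t - t') /
      ((q + t * q') * (q + t' * q'))); last first.
    by field; rewrite !gt_eqF.
  by rewrite !normrM distrC det mul1r normfV [X in _ / X]gtr0_norm// mulr_gt0.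
exists q, q'; split => //.
rewrite /cf_len dist// subr0 normr1 mul0r addr0 mul1r mul1r mulrC //.
Qed.

Lemma cf_len_gt0 w : all (leq 1) w -> 0 < cf_len w.
Proof.
move=> /cf_len_moebius[q [q' [q0 /andP[q'0 q'q] _ -> _]]].
by rewrite invr_gt0; nra.
Qed.

Lemma cf_len_le w : all (leq 1) w -> cf_len w <= 2^-1 ^+ size w.
Proof.
move=> /cf_len_moebius[q [q' [q0 /andP[q'0 q'q] sz -> _]]].
by rewrite exprVn lef_pV2// posrE ?exprn_gt0//; nra.
Qed.

Lemma cf_map_dist_ge w t t' : all (leq 1) w -> 0 <= t <= 1 -> 0 <= t' <= 1 ->
  cf_len w / 2 * `|t - t'| <= `|cf_map w t - cf_map w t'|.
Proof.
move=> /cf_len_moebius[q [q' [q0 /andP[q'0 q'q] _ -> E]]] /andP[? ?] /andP[? ?].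
rewrite E// [leLHS]mulrC ler_wpM2l// -invfM lef_pV2 ?posrE.
- apply: (le_trans (y := (q + q') * (q + q'))); last nra.
  by apply: ler_pM; nra.
- by apply: mulr_gt0; nra.
- by apply: mulr_gt0; nra.
Qed.

Lemma cf_map_dist_le w t t' : all (leq 1) w -> 0 <= t <= 1 -> 0 <= t' <= 1 ->
  `|cf_map w t - cf_map w t'| <= 2 * cf_len w * `|t - t'|.
Proof.
move=> /cf_len_moebius[q [q' [q0 /andP[q'0 q'q] _ -> E]]] /andP[? ?] /andP[? ?].
rewrite E// [leRHS]mulrC ler_wpM2l// -[2]invrK -invfM lef_pV2 ?posrE.
- apply: (le_trans (y := q * q)); first nra.
  by apply: ler_pM; nra.
- by apply: mulr_gt0; nra.
- by apply: mulr_gt0; nra.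
Qed.

Fixpoint words (M n : nat) : seq (seq nat) :=
  if n is n'.+1 then [seq rcons w b | w <- words M n', b <- iota 1 M]
  else [:: [::]].

Lemma words_spec M n w : w \in words M n ->
  size w = n /\ all (fun b => (0 < b <= M)%N) w.
Proof.
elim: n w => [|n IHn] w /=; first by rewrite inE => /eqP->.
case/allpairsP => -[v b] /= [/IHn[<- vM]]; rewrite mem_iota => b1 ->.
by rewrite size_rcons all_rcons vM andbT; split => //; lia.
Qed.

Lemma words_pos M n w : w \in words M n -> all (leq 1) w.
Proof. by move=> /words_spec[_]; apply: sub_all => b /andP[]. Qed.

Lemma words_uniq M n : uniq (words M n).
Proof.
elim: n => //= n IHn; apply: allpairs_uniq; rewrite ?iota_uniq//.
by move=> [w b] [w' b'] _ _ /= /rcons_inj[-> ->].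
Qed.

(** The children of w with last symbol at most M cover its cylinder except the
    part between [cf_map w 0] and [cf_map w (1 / (M + 1))], whose relative length
    is at most 2 / (M + 1) by bounded distortion. *)
Lemma sum_cf_len_rcons M w : all (leq 1) w ->
  cf_len w * (1 - 2 / M.+1%:R) <= \sum_(b <- iota 1 M) cf_len (rcons w b).
Proof.
move=> w0.
have tel k : `|cf_map w 1 - cf_map w k.+1%:R^-1|
    <= \sum_(b <- iota 1 k) cf_len (rcons w b).
  elim: k => [|k IHk]; first by rewrite invr1 subrr normr0 big_nil.
  have -> : iota 1 k.+1 = iota 1 k ++ [:: k.+1] by rewrite -[in LHS](addn1 k) iotaD.
  rewrite big_cat big_seq1 /=.
  apply: le_trans (lerD IHk (lexx _)).
  rewrite /cf_len !cf_map_rcons addr0 natr1 [X in _ <= _ + X]distrC.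
  exact: ler_distD.
have M0 : 0 <= (M.+1%:R^-1 : R) <= 1.
  by have := inv_itv M.+1 0 isT (lexx _); rewrite addr0.
have M1 : 0 <= (0 : R) <= 1 by rewrite lexx ler01.
have := cf_map_dist_le _ _ _ w0 M0 M1; rewrite subr0 => low.
have := ler_distD (cf_map w M.+1%:R^-1) (cf_map w 1) (cf_map w 0).
rewrite -/(cf_len w) => tri; have := tel M.
move: low; rewrite [X in _ * X]ger0_norm; last by case/andP: M0.
set x := M.+1%:R^-1 => dist_low dist_tel.
have -> : cf_len w * (1 - 2 * x) = cf_len w - 2 * cf_len w * x by ring.
by rewrite lerBlDr; apply: le_trans tri _; exact: lerD.
Qed.

Lemma sum_cf_len_words M n : (1 <= M)%N ->
  (1 - 2 / M.+1%:R) ^+ n <= \sum_(w <- words M n) cf_len w.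
Proof.
move=> M1; have M2 : 0 <= 1 - 2 / M.+1%:R :> R.
  by rewrite subr_ge0 ler_pdivrMr ?ltr0n// mul1r ler_nat.
elim: n => [|n IHn].
  by rewrite big_seq1 expr0 /cf_len /= subr0 normr1.
rewrite exprSr (le_trans (ler_wpM2r M2 IHn))//= big_allpairs_dep mulr_suml.
rewrite big_seq [leRHS]big_seq; apply: ler_sum => w /words_pos w0.
exact: sum_cf_len_rcons.
Qed.

(** The loss per symbol is 2 / (M + 1), so M of order 4 n keeps the total loss
    below 1 / 2, by Bernoulli's inequality. *)
Lemma words_fill n : exists M, 2^-1 <= \sum_(w <- words M n) cf_len w.
Proof.
exists (4 * n).+1; apply: le_trans (sum_cf_len_words _ _ _) => //.
set x := 2 / _; have x0 : 0 <= x by rewrite divr_ge0.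
have x1 : x <= 1 by rewrite ler_pdivrMr ?ltr0n// mul1r ler_nat.
have bernoulli k : 1 - k%:R * x <= (1 - x) ^+ k.
  elim: k => [|k IHk]; first by rewrite mul0r subr0 expr0.
  have [h|h] := leP (1 - k%:R * x) 0.
    apply: (le_trans (y := 0)); last by rewrite exprn_ge0// subr_ge0.
    by rewrite -natr1 mulrDl mul1r; lra.
  rewrite exprS -natr1.
  have k0 : 0 <= (k%:R : R) by [].
  have : (1 - x) * (1 - k%:R * x) <= (1 - x) * (1 - x) ^+ k.
    by rewrite ler_wpM2l// subr_ge0.
  have := mulr_ge0 (mulr_ge0 k0 x0) x0; nra.
apply: le_trans (bernoulli n); rewrite lerBrDr -lerBrDl.
rewrite /x mulrA ler_pdivrMr ?ltr0n//.
have -> : (4 * n).+2%:R = 4 * n%:R + 2 :> R by rewrite -addn2 natrD natrM.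
by have : 0 <= (n%:R : R) by []; lra.
Qed.

End cylinders.

(** * A dyadic pigeonhole *)

Section pigeonhole.
Context {R : realType}.
Implicit Types (s x C : R).

Lemma powRX x s n : 0 <= x -> (x ^+ n) `^ s = (x `^ s) ^+ n.
Proof.
by move=> x0; rewrite -powR_mulrn// -powRrM mulrC powRrM powR_mulrn// powR_ge0.
Qed.

Lemma expr_small (z e : R) : 0 <= z < 1 -> 0 < e -> exists n, z ^+ n < e.
Proof.
move=> /andP[z0 z1] e0.
have /cvgrPdist_lt/(_ _ e0)[n _ nP] : (GRing.exp z : R^nat) @ \oo --> 0.
  by apply: cvg_expr; rewrite ger0_norm.
exists n; have := nP n (leqnn n).
by rewrite sub0r normrN ger0_norm ?exprn_ge0.
Qed.

(** The largest power 2^-(n + i) not exceeding x is more than x / 2, except for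
    i = 0 where x <= 2^-n is known; it is one of the terms of the sum. *)
Lemma dyadic_bound x n : 0 < x <= 2^-1 ^+ n ->
  exists J, forall K, (J <= K)%N ->
    x <= 2 * \sum_(i < K) 2^-1 ^+ (n + i) * ((2^-1 ^+ (n + i) <= x)%R)%:R.
Proof.
move=> /andP[x0 xn].
have [J0 J0x] : exists J, 2^-1 ^+ (n + J) <= x.
  have [||J /ltW Jx] := @expr_small 2^-1 x; rewrite ?x0//; first lra.
  exists J; apply: le_trans Jx.
  by rewrite addnC exprD ler_piMr ?exprn_ge0// exprn_ile1; lra.
have exJ : exists J, 2^-1 ^+ (n + J) <= x by exists J0.
case: (ex_minnP exJ) => J Jx Jmin.
have xJ : x <= 2 * 2^-1 ^+ (n + J).
  case: J Jmin Jx => [_ _|J Jmin _].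
    by rewrite addn0; have : 0 <= (2^-1 : R) ^+ n by []; lra.
  rewrite addnS exprS mulrA divff// mul1r leNgt; apply/negP => /ltW/Jmin.
  by rewrite ltnn.
exists J.+1 => K JK; apply: le_trans xJ _; rewrite ler_wpM2l//.
rewrite (bigD1 (Ordinal JK))//= Jx mulr1 lerDl.
by apply: sumr_ge0 => j _; rewrite mulr_ge0 ?exprn_ge0 ?invr_ge0.
Qed.

Lemma sum_expr_le (z : R) K : 0 <= z < 1 -> \sum_(i < K) z ^+ i <= (1 - z)^-1.
Proof.
move=> /andP[z0 z1]; rewrite -[leRHS]mul1r ler_pdivlMr ?subr_gt0//.
rewrite mulrC -[_ * _]opprK -mulNr opprB -subrX1 opprB.
by rewrite gerBl exprn_ge0.
Qed.

(** If fewer than C r^-s members had size at least r, for every r, then the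
    layers r = 2^-j with j >= n would contribute less than C 2^(-j (1 - s)) each
    to the total size, and the geometric tail is below 1 / 2 once n is large.
    The point is that n depends on s and C only, not on the family. *)
Lemma dyadic_pigeonhole s C : 0 <= s < 1 -> 0 < C -> exists n : nat,
  forall (T : eqType) (l : seq T) (f : T -> R),
    (forall y, y \in l -> 0 < f y <= 2^-1 ^+ n) -> 2^-1 <= \sum_(y <- l) f y ->
  exists r, 0 < r /\ C <= (count (fun y => (r <= f y)%R) l)%:R * r `^ s.
Proof.
move=> /andP[s0 s1] C0.
pose b : R := 2^-1 `^ s; pose z : R := 2^-1 `^ (1 - s).
have b0 : 0 < b by rewrite powR_gt0.
have z0 : 0 <= z by exact: powR_ge0.
have z1 : z < 1.
  rewrite -[ltRHS](congr1 (@^~ (1 - s)) (powR1 R)).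
  by rewrite gt0_ltr_powR ?nnegrE ?subr_gt0 ?ler01//; lra.
have bz : 2^-1 = b * z.
  by rewrite -powRD ?subrKC ?powRr1// oner_eq0.
have e0 : 0 < (1 - z) / (4 * C) by rewrite divr_gt0 ?subr_gt0 ?mulr_gt0.
have [|n zn] := expr_small z _ _ e0; first by rewrite z0.
exists n => T l f fl; apply: contraPP => noR; apply/negP; rewrite -ltNge.
have few r : 0 < r -> (count (fun y => (r <= f y)%R) l)%:R * r `^ s < C.
  by move=> r0; rewrite ltNge; apply/negP => ?; apply: noR; exists r.
(* one truncation J of the dyadic sum serves the whole finite family *)
have [J fJ] : exists J, forall x : T, x \in l -> forall K, (J <= K)%N ->
    f x <= 2 * \sum_(i < K) 2^-1 ^+ (n + i) * ((2^-1 ^+ (n + i) <= f x)%R)%:R.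
  elim: l fl {noR few} => [|y l IHl] fl; first by exists 0.
  have [J JP] := dyadic_bound _ _ (fl y (mem_head _ _)).
  have [|J' J'P] := IHl; first by move=> x xl; apply: fl; rewrite inE xl orbT.
  exists (maxn J J') => x; rewrite inE => /predU1P[->|xl] K; rewrite geq_max.
    by case/andP => /JP.
  by case/andP => _; exact: J'P.
apply: (@le_lt_trans _ _ (2 * \sum_(i < J) C * z ^+ (n + i))).
  apply: (@le_trans _ _ (\sum_(x <- l) 2 * \sum_(i < J) 2^-1 ^+ (n + i) *
      ((2^-1 ^+ (n + i) <= f x)%R)%:R)).
    by rewrite big_seq [leRHS]big_seq; apply: ler_sum => x xl; exact: fJ.
  rewrite -mulr_sumr ler_wpM2l// exchange_big; apply: ler_sum => i _ /=.
  rewrite -mulr_sumr -natr_sum.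
  set k := (\sum_(x <- l) _)%N.
  have -> : k = count (fun y => (2^-1 ^+ (n + i) <= f y)%R) l.
    by rewrite -sum1_count [RHS]big_mkcond; apply: eq_bigr => x _; case: (_ <= _).
  rewrite {1}bz exprMn mulrAC ler_wpM2r ?exprn_ge0// mulrC -powRX//.
  by apply/ltW/few; rewrite exprn_gt0.
under eq_bigr do rewrite exprD mulrA.
rewrite -mulr_sumr mulrA.
apply: (@le_lt_trans _ _ (2 * (C * z ^+ n) / (1 - z))).
  rewrite ler_wpM2l ?sum_expr_le ?z0//.
  by rewrite !mulr_ge0 ?exprn_ge0// ltW.
rewrite ltr_pdivrMr ?subr_gt0//.
move: zn; rewrite ltr_pdivlMr ?mulr_gt0//; lra.
Qed.

End pigeonhole.

(** * Infinite continued fractions *)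

Section infinite_cf.
Context {R : realType}.
Implicit Types (a : nat^nat) (x : R).

Definition cf a : R := lim (cf_value (mkseq a n) @[n --> \oo]).

Definition digits_gt0 a := forall n, (0 < a n)%N.

Definition tail a : nat^nat := fun i => a i.+1.

Lemma mkseq_tail a n : mkseq a n.+1 = a 0%N :: mkseq (tail a) n.
Proof. by rewrite /mkseq/= (iotaDl 1 0) -map_comp. Qed.

Lemma mkseq_cat a n k : mkseq a (n + k) = mkseq a n ++ mkseq (fun i => a (n + i)%N) k.
Proof. by rewrite /mkseq iotaD map_cat add0n -[n in iota n k]addn0 iotaDl -map_comp. Qed.

Lemma mkseq_gt0 a n : digits_gt0 a -> all (leq 1) (mkseq a n).
Proof. by move=> a0; rewrite all_map; apply/allP => i _ /=. Qed.

Lemma cf_value_itv a n : digits_gt0 a -> 0 <= (cf_value (mkseq a n) : R) <= 1.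
Proof.
by move=> a0; apply: cf_map_itv; rewrite ?lexx ?ler01 ?mkseq_gt0.
Qed.

(** From rank n on, the convergents lie in the cylinder of the first n symbols,
    whose length is at most 2^-n. *)
Lemma cf_cvg a : digits_gt0 a -> (cf_value (mkseq a n) : R) @[n --> \oo] --> cf a.
Proof.
move=> a0; apply: cauchy_cvg.
apply: cauchy_exP => e e0.
have [||n nP] := @expr_small R 2^-1 (e / 2); rewrite ?divr_gt0 ?invr_ge0 ?ler0n//=.
  by lra.
exists (cf_value (mkseq a n)), n => //= m nm.
rewrite -ball_normE /ball_ /= -(subnKC nm) mkseq_cat !cf_value_map cf_map_cat.
have h0 : 0 <= (0 : R) <= 1 by rewrite lexx ler01.
have h1 := cf_value_itv (fun i => a (n + i)%N) (m - n) (fun i => a0 _).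
apply: le_lt_trans (cf_map_dist_le _ _ _ (mkseq_gt0 a n a0) h0 h1) _.
rewrite sub0r normrN ger0_norm; last by case/andP: h1.
have := @cf_len_le R (mkseq a n) (mkseq_gt0 a n a0); rewrite size_mkseq => len.
have := ltW (@cf_len_gt0 R (mkseq a n) (mkseq_gt0 a n a0)) => len0.
apply: (@le_lt_trans _ _ (2 * cf_len (mkseq a n) * 1)).
  by case/andP: h1 => _ h1; apply: ler_wpM2l => //; rewrite mulr_ge0.
by rewrite mulr1; lra.
Qed.

Lemma cf_itv a : digits_gt0 a -> 0 <= cf a <= 1.
Proof.
move=> a0; apply/andP; split.
  by apply: (cvgr_to_ge (cf_cvg a a0)); near=> n; have /andP[] := cf_value_itv a n a0.
by apply: (cvgr_to_le (cf_cvg a a0)); near=> n; have /andP[] := cf_value_itv a n a0.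
Unshelve. all: by end_near. Qed.

Lemma cf_tail a : digits_gt0 a -> cf a = ((a 0)%:R + cf (tail a))^-1.
Proof.
move=> a0; have t0 : digits_gt0 (tail a) by move=> n; exact: a0.
have := cf_cvg a a0; rewrite -cvg_shiftS => /cvg_lim <- //; apply/cvg_lim => //.
under [X in X @ _]eq_fun do rewrite mkseq_tail /=.
apply: cvgV; last by apply: cvgD; [exact: cvg_cst|exact: cf_cvg].
have /andP[t1 _] := cf_itv _ t0; have := digit_ge1 (R := R) _ (a0 0%N).
by move=> ?; rewrite gt_eqF//; lra.
Qed.

Lemma cf_gt0_lt1 a : digits_gt0 a -> 0 < cf a < 1.
Proof.
have pos b : digits_gt0 b -> 0 < cf b.
  move=> b0; have /andP[t0 _] := cf_itv (tail b) (fun n => b0 _).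
  rewrite cf_tail// invr_gt0; have := digit_ge1 (R := R) _ (b0 0%N); lra.
move=> a0; rewrite pos//= cf_tail//.
have := pos (tail a) (fun n => a0 _); have := digit_ge1 (R := R) _ (a0 0%N) => *.
by rewrite invf_lt1; lra.
Qed.

Lemma cf_cat a n : digits_gt0 a -> cf a = cf_map (mkseq a n) (cf (fun i => a (n + i)%N)).
Proof.
elim: n a => [//|n IHn] a a0; rewrite mkseq_tail cf_tail//=.
by rewrite (IHn (tail a)) // => k; exact: a0.
Qed.

Lemma natr_frac_inj (m n : nat) (x y : R) : 0 < x < 1 -> 0 < y < 1 ->
  m%:R + x = n%:R + y -> m = n.
Proof.
move=> /andP[x0 x1] /andP[y0 y1] E.
have [mn|nm|//] := ltngtP m n.
- have : m%:R + 1 <= n%:R :> R by rewrite natr1 ler_nat.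
  by move=> ?; exfalso; lra.
- have : n%:R + 1 <= m%:R :> R by rewrite natr1 ler_nat.
  by move=> ?; exfalso; lra.
Qed.

(** The first symbol is the integer part of 1 / [cf a], and [cf (tail a)] is the
    fractional part. *)
Lemma cf_inj a b : digits_gt0 a -> digits_gt0 b -> cf a = cf b -> a = b.
Proof.
have head c d : digits_gt0 c -> digits_gt0 d -> cf c = cf d ->
    c 0%N = d 0%N /\ cf (tail c) = cf (tail d).
  move=> c0 d0; have tc0 : digits_gt0 (tail c) by move=> n; exact: c0.
  have td0 : digits_gt0 (tail d) by move=> n; exact: d0.
  rewrite cf_tail// (cf_tail d)// => /invr_inj E.
  have cd : c 0%N = d 0%N.
    by apply: natr_frac_inj E; exact: cf_gt0_lt1.
  by split => //; move: E; rewrite cd => /addrI.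
move=> a0 b0 E; apply/funext => n.
elim: n a b a0 b0 E => [|n IHn] a b a0 b0 E.
  by have [] := head a b a0 b0 E.
have [_ tE] := head a b a0 b0 E.
by apply: (IHn (tail a) (tail b)) => // k; [exact: a0|exact: b0].
Qed.

(** Descent: if [cf a] = c / d then c < d and [cf (tail a)] is a fraction with
    denominator c. *)
Lemma cf_irrational a : digits_gt0 a -> irrational (cf a).
Proof.
move=> a0 /rationalP[p [d]].
have /andP[cf0 _] := cf_gt0_lt1 a a0.
case: p => [c|c] E; last first.
  move: cf0; rewrite E NegzE mulrNz mulNr oppr_gt0 ltNge.
  by rewrite divr_ge0.
rewrite {cf0} -pmulrn in E.
elim/ltn_ind: d a a0 c E => d IHd a a0 c E.
have /andP[cf0 cf1] := cf_gt0_lt1 a a0.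
have d0 : (0 : R) < d%:R.
  by move: cf0; rewrite E; case: d {E IHd} => [|d]; rewrite ?invr0 ?mulr0 ?ltxx// ltr0n.
have c0 : (0 : R) < c%:R by move: cf0; rewrite E pmulr_lgt0 ?invr_gt0.
have cd : (c < d)%N by move: cf1; rewrite E ltr_pdivrMr// mul1r ltr_nat.
have t0 : digits_gt0 (tail a) by move=> n; exact: a0.
have /andP[cft _] := cf_gt0_lt1 _ t0.
have Et : cf (tail a) = d%:R / c%:R - (a 0)%:R.
  move: E; rewrite cf_tail// => /(congr1 GRing.inv); rewrite invrK invf_div => <-.
  by rewrite addrC addKr.
have le : (a 0 * c <= d)%N.
  move: cft; rewrite Et subr_gt0 ltr_pdivlMr// -natrM ltr_nat => /ltnW //.
apply: (IHd c cd (tail a) t0 (d - a 0 * c)%N).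
by rewrite Et natrB// natrM mulrBl mulfK ?gt_eqF.
Qed.

Lemma cf_partial_quotient a n : digits_gt0 a -> partial_quotient (cf a) n = a n.-1.
Proof.
move=> a0; rewrite /partial_quotient (get_unique (x := a))//.
  by split => //; exact: cf_cvg.
move=> b [b0 /cvg_lim bE]; apply: cf_inj => //.
by rewrite {1}/cf bE.
Qed.

End infinite_cf.

(** * Separation of expansions built from blocks *)

Section coding.
Context {R : realType}.
Implicit Types (a b d : nat^nat) (M K : nat).

Lemma inv_dist_ge (N u v : R) : 1 <= u <= N -> 1 <= v <= N ->
  N^-1 ^+ 2 * `|u - v| <= `|u^-1 - v^-1|.
Proof.
move=> /andP[u1 uN] /andP[v1 vN].
have u0 : 0 < u by lra.
have v0 : 0 < v by lra.
have -> : u^-1 - v^-1 = (v - u) / (u * v) by field; rewrite !gt_eqF.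
rewrite normrM distrC mulrC ler_wpM2l// ger0_norm; last first.
  by rewrite invr_ge0 mulr_ge0// ltW.
by rewrite exprVn expr2 lef_pV2 ?posrE ?mulr_gt0//; [apply: ler_pM; lra|lra|lra].
Qed.

Lemma cf_map_dist_ge_letters M w (t t' : R) : all (fun c => 0 < c <= M)%N w ->
  0 <= t <= 1 -> 0 <= t' <= 1 ->
  (M.+1%:R^-1 ^+ 2) ^+ size w * `|t - t'| <= `|cf_map w t - cf_map w t'|.
Proof.
move=> wM t01 t'01; elim: w wM => [_|c w IHw]; first by rewrite expr0 mul1r.
move=> /andP[/andP[c1 cM] wM] /=.
have w1 : all (leq 1) w by apply: sub_all wM => ? /andP[].
have range (s : R) : 0 <= s <= 1 -> 1 <= c%:R + cf_map w s <= M.+1%:R.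
  move=> /(cf_map_itv _ _ w1)/andP[s0 s1]; apply/andP; split.
    by have := @digit_ge1 R _ c1; lra.
  by rewrite -natr1 lerD// ler_nat.
apply: le_trans (inv_dist_ge _ _ _ (range _ t01) (range _ t'01)).
rewrite exprS -mulrA ler_wpM2l ?exprn_ge0 ?invr_ge0//.
by rewrite opprD addrACA subrr add0r IHw.
Qed.

(** With symbols at most M, values are at least beta = 1 / (M + 1). At the first
    disagreement, the integer parts differ by at least 1 and the fractional parts
    by at most 1 - beta, so the arguments of the inversion are beta apart; an
    inversion multiplies distances by at least beta ^ 2. *)
Lemma cf_gap M a b L : (forall i, 0 < a i <= M)%N -> (forall i, 0 < b i <= M)%N ->
  mkseq a L <> mkseq b L ->
  M.+1%:R^-1 ^+ (3 * L) <= `|cf a - cf b :> R|.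
Proof.
set beta : R := M.+1%:R^-1.
have beta0 : 0 <= beta by rewrite invr_ge0.
have beta1 : beta <= 1 by rewrite invf_le1 ?ltr0n// ler1n.
have pos c : (forall i, 0 < c i <= M)%N -> digits_gt0 c.
  by move=> cM i; have /andP[] := cM i.
have low c : (forall i, 0 < c i <= M)%N ->
    beta <= cf c /\ 1 <= (c 0%N)%:R + (cf (tail c) : R) <= M.+1%:R.
  move=> cM; have c0 := pos c cM.
  have /andP[t0 t1] := cf_itv (R := R) (tail c) (fun i => c0 _).
  have /andP[h1 h2] := cM 0%N; have := @digit_ge1 R _ h1.
  have h3 : (c 0%N)%:R + 1 <= M.+1%:R :> R by rewrite natr1 ler_nat.
  move=> h4; have h5 : 1 <= (c 0%N)%:R + (cf (tail c) : R) <= M.+1%:R by lra.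
  by split => //; rewrite cf_tail// lef_pV2 ?posrE ?ltr0n//; lra.
elim: L a b => [//|L IHL] a b aM bM.
have [aL a1] := low a aM; have [bL b1] := low b bM.
rewrite !mkseq_tail => ab; rewrite (cf_tail a) ?(cf_tail b); try exact: pos.
apply: le_trans (inv_dist_ge _ _ _ a1 b1).
rewrite -/beta mulnS exprD (exprD _ 2 1) expr1 -mulrA ler_wpM2l ?exprn_ge0//.
have /andP[ta0 ta1] := cf_itv (R := R) (tail a) (fun i => pos a aM _).
have /andP[tb0 tb1] := cf_itv (R := R) (tail b) (fun i => pos b bM _).
have [taL _] := low (tail a) (fun i => aM _).
have [tbL _] := low (tail b) (fun i => bM _).
have [ab0|ab0] := eqVneq (a 0%N) (b 0%N).
  rewrite ab0 opprD addrACA subrr add0r.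
  apply: le_trans (IHL (tail a) (tail b) (fun i => aM _) (fun i => bM _) _).
    by rewrite ler_piMl ?exprn_ge0.
  by move: ab; rewrite ab0 => /[swap] ->.
apply: (@le_trans _ _ beta).
  by rewrite ler_piMr// exprn_ile1.
have [ltab|ltba|eqab] := ltngtP (a 0%N) (b 0%N).
- rewrite distrC ger0_norm; last first.
    have : (a 0%N)%:R + 1 <= (b 0%N)%:R :> R by rewrite natr1 ler_nat.
    lra.
  have : (a 0%N)%:R + 1 <= (b 0%N)%:R :> R by rewrite natr1 ler_nat.
  lra.
- rewrite ger0_norm; last first.
    have : (b 0%N)%:R + 1 <= (a 0%N)%:R :> R by rewrite natr1 ler_nat.
    lra.
  have : (b 0%N)%:R + 1 <= (a 0%N)%:R :> R by rewrite natr1 ler_nat.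
  lra.
- by rewrite eqab eqxx in ab0.
Qed.

Definition prepend K lambda b : nat^nat :=
  fun i => if (i < K)%N then lambda else b (i - K)%N.

Lemma cf_prepend K lambda b : (0 < lambda)%N -> digits_gt0 b ->
  cf (prepend K lambda b) = cf_map (nseq K lambda) (cf b : R).
Proof.
move=> lambda0 b0; rewrite (cf_cat _ K); last first.
  by move=> i; rewrite /prepend; case: ifP.
congr (cf_map _ (cf _)).
  apply: (@eq_from_nth _ 1%N) => [|i]; rewrite size_mkseq ?size_nseq// => iK.
  by rewrite nth_mkseq// nth_nseq /prepend iK.
by apply/funext => i; rewrite /prepend ltnNge leq_addr addKn.
Qed.

(** The concatenation of the words [wd (d 0)], [wd (d 1)], ... of common length
    K, in which case the default value 1 is never read. *)
Definition blocks K (wd : nat -> seq nat) d : nat^nat :=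
  fun i => nth 1%N (wd (d (i %/ K)%N)) (i %% K)%N.

Lemma blocks_head K wd d : size (wd (d 0%N)) = K ->
  mkseq (blocks K wd d) K = wd (d 0%N).
Proof.
move=> szw; apply: (@eq_from_nth _ 1%N) => [|i]; rewrite size_mkseq ?szw// => iK.
by rewrite nth_mkseq// /blocks divn_small// modn_small.
Qed.

Lemma cf_blocks K wd d : (0 < K)%N -> size (wd (d 0%N)) = K ->
  digits_gt0 (blocks K wd d) ->
  cf (blocks K wd d) = cf_map (wd (d 0%N)) (cf (blocks K wd (tail d)) : R).
Proof.
move=> K0 szw b0; rewrite (cf_cat _ K)// blocks_head//; congr (cf_map _ (cf _)).
apply/funext => i; rewrite /blocks /tail modnDl divnDl ?dvdnn//.
by rewrite divnn K0.
Qed.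

(** Peeling off one common block multiplies the distance by at least rho; delta
    accounts for the block where the two codes part. *)
Lemma cf_blocks_sep K m wd (rho delta : R) : (0 < K)%N -> 0 <= rho ->
  (forall j, (j < m)%N -> size (wd j) = K /\ all (leq 1) (wd j)) ->
  (forall j t t', (j < m)%N -> 0 <= t <= 1 -> 0 <= t' <= 1 ->
    rho * `|t - t'| <= `|cf_map (wd j) t - cf_map (wd j) t'|) ->
  (forall d d', (forall i, (d i < m)%N) -> (forall i, (d' i < m)%N) ->
    d 0%N <> d' 0%N ->
    delta <= `|cf (blocks K wd d) - cf (blocks K wd d')|) ->
  forall n d d', (forall i, (d i < m)%N) -> (forall i, (d' i < m)%N) ->
    (forall i, (i < n)%N -> d i = d' i) -> d n <> d' n ->
  rho ^+ n * delta <= `|cf (blocks K wd d) - cf (blocks K wd d')|.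
Proof.
move=> K0 rho0 wdK lip gap.
have pos d : (forall i, (d i < m)%N) -> digits_gt0 (blocks K wd d).
  move=> dm i; have [szw /allP w1] := wdK _ (dm (i %/ K)%N).
  by apply/w1/mem_nth; rewrite szw ltn_pmod.
elim=> [|n IHn] d d' dm d'm dd' ddn; first by rewrite mul1r; exact: gap.
have tdm i : (tail d i < m)%N by exact: dm.
have td'm i : (tail d' i < m)%N by exact: d'm.
rewrite cf_blocks//; [|by have [] := wdK _ (dm 0%N)|exact: pos].
rewrite (cf_blocks _ _ d')//; [|by have [] := wdK _ (d'm 0%N)|exact: pos].
rewrite -dd'// exprS -mulrA.
apply: le_trans (lip _ _ _ (dm 0%N) (cf_itv _ (pos _ tdm)) (cf_itv _ (pos _ td'm))).
by rewrite ler_wpM2l//; apply: IHn => // i ilt; exact: dd'.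
Qed.

(** A run of mu <> lambda starts at a rank at least K, because the first K
    symbols are lambda, and it is shorter than K, because among K consecutive
    ranks one is a multiple of K. The initial run of lambda has length
    min (n, K) at time n. *)
Lemma longest_run_lt K lambda a n mu : (0 < K)%N -> digits_gt0 a ->
  (forall i, (i < K)%N || (K %| i)%N -> a i = lambda) ->
  (0 < n)%N -> mu <> lambda ->
  (longest_run n (cf a : R) mu < longest_run n (cf a : R) lambda)%N.
Proof.
move=> K0 a0 aK n0 mul.
(* min (n, K) is the threshold that separates the two longest runs *)
have [k kE] : exists k, minn n K = k.+1 by exists (minn n K).-1; lia.
pose P nu j l := (\prod_(1 <= i < l.+1) (partial_quotient (cf a : R) (j + i) == nu))%N.
have PE nu j l : P nu j l = (\prod_(1 <= i < l.+1) (a (j + i).-1 == nu))%N.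
  by apply: eq_bigr => i _; rewrite cf_partial_quotient.
have P1 nu j l : (P nu j l <= 1)%N.
  rewrite PE; apply: (big_ind (fun x => x <= 1)%N) => // [x y|i _].
    by case: x y => [|[]] [|[]].
  by case: (_ == _).
have P0 j l i : (0 < i <= l)%N -> a (j + i).-1 = lambda -> P mu j l = 0%N.
  move=> il ai; rewrite PE (bigD1_seq i) ?iota_uniq ?mem_index_iota//=.
  by rewrite ai; case: eqP => [/esym//|]; rewrite mul0n.
have Plambda l : (l <= K)%N -> P lambda 0%N l = 1%N.
  move=> lK; rewrite PE big_nat_cond big1 // => i /andP[/andP[i1 il] _].
  by rewrite aK ?eqxx// add0n; apply/orP; left; lia.
rewrite /longest_run; apply: (@leq_trans (minn n K)).
  rewrite kE ltnS; apply/bigmax_leqP_seq => j; rewrite mem_index_iota => /andP[_ jn] _.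
  rewrite -/(P mu _ _); under eq_bigr do rewrite -/(P mu j _).
  have [jK|Kj] := ltnP j K.
    rewrite big_nat_cond big1 // => l /andP[/andP[l1 _] _].
    by apply: (P0 _ _ 1%N) => //; rewrite addn1 aK// jK.
  apply: (@leq_trans (\sum_(1 <= l < (n - j).+1) (l < K))%N).
    rewrite !big_nat; apply: leq_sum => l l1.
    have [lK|Kl] := ltnP l K; first exact: P1.
    rewrite leqn0; apply/eqP.
    (* q K is the first multiple of K which is at least j *)
    pose q := ((j + K.-1) %/ K)%N; have qj : (j <= q * K < j + K)%N.
      have := divn_eq (j + K.-1) K; have := ltn_pmod (j + K.-1) K0.
      by rewrite -/q; lia.
    apply: (P0 _ _ (q * K - j).+1); first by lia.
    by rewrite aK//; apply/orP; right; rewrite addnS/= subnKC; [exact: dvdn_mull|lia].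
  have -> : k = K.-1 by lia.
  have [njK|Knj] := leqP (n - j).+1 K.
    rewrite big_nat_cond (eq_bigr (fun=> 1%N)); last first.
      by move=> l /andP[/andP[_ /leq_trans/(_ njK)->]].
    by rewrite -big_nat_cond sum_nat_const_nat muln1; lia.
  rewrite (@big_cat_nat _ _ _ K)//=; last exact: ltnW.
  rewrite [X in (_ + X)%N]big_nat_cond [X in (_ + X)%N]big1 ?addn0; last first.
    by move=> l /andP[/andP[Kl _] _]; rewrite ltnNge Kl.
  rewrite big_nat_cond (eq_bigr (fun=> 1%N)); last by move=> l /andP[/andP[_ ->]].
  by rewrite -big_nat_cond sum_nat_const_nat muln1; lia.
apply: leq_trans (leq_bigmax_seq 0%N _ _) => //; last by rewrite mem_index_iota.
rewrite subn0 (@big_cat_nat _ _ _ (minn n K).+1)//=; last by rewrite ltnS geq_minl.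
apply: leq_trans (leq_addr _ _).
rewrite big_nat_cond (eq_bigr (fun=> 1%N)); last first.
  move=> l /andP[/andP[_ ln] _]; rewrite -/(P lambda 0%N l) Plambda//.
  by rewrite ltnS leq_min in ln; case/andP: ln.
by rewrite -big_nat_cond sum_nat_const_nat muln1 subn1.
Qed.
End coding.

(** * Hausdorff measure estimates *)

Section hausdorff_estimates.
Context {R : realType}.
Implicit Types (A U : set R) (s C : R).

Lemma diam_ge U (x y : R) : U x -> U y -> (`|x - y|%:E <= diam U)%E.
Proof. by move=> Ux Uy; apply: ereal_sup_ubound; exists (x, y). Qed.

Lemma diam_pow_ge0 s U : (0 <= diam_pow s U)%E.
Proof. by rewrite /diam_pow; case: ifP => // _; exact: poweR_ge0. Qed.

Lemma hausdorff_premeasure_ge0 s delta A : (0 <= hausdorff_premeasure s delta A)%E.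
Proof.
apply: le_ereal_inf_tmp => _ [U _ <-].
by apply: nneseries_ge0 => k _ _; exact: diam_pow_ge0.
Qed.

(** A mass distribution principle in which the mass is the image of Lebesgue
    measure under g: a set U of diameter D pulls back into an interval of length
    2 C D^s, and these intervals must cover [0, 1). *)
Lemma hausdorff_measure_neq0_of_holder A (g : R -> R) s C : 0 <= s -> 0 < C ->
  (forall y, 0 <= y < 1 -> A (g y)) ->
  (forall y y', 0 <= y < 1 -> 0 <= y' < 1 ->
    `|y - y'| <= C * `|g y - g y'| `^ s) ->
  hausdorff_measure s A != 0%E.
Proof.
move=> s0 C0 gA holder; apply/eqP => HA0.
suff : ((2 * C)^-1%:E <= hausdorff_measure s A)%E.
  by rewrite HA0 lee_fin leNgt invr_gt0 mulr_gt0.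
apply: (@le_trans _ _ (hausdorff_premeasure s 1 A)); last first.
  by apply: ereal_sup_ubound; exists 1 => //=.
apply: le_ereal_inf_tmp => _ [U [U1 UA] <-].
(* an empty interval serves the sets U k that g misses *)
have fit k : exists I : interval R,
    (forall y, 0 <= y < 1 -> U k (g y) -> [set` I] y) /\
    (lebesgue_measure [set` I] <= (2 * C)%:E * diam_pow s (U k))%E.
  have [[y0 [y01 Uy0]]|noy] := pselect (exists y, 0 <= y < 1 /\ U k (g y)); last first.
    exists `]0, 0[; split; first by move=> y y01 Uy; exfalso; apply: noy; exists y.
    rewrite lebesgue_measure_itv /= ltxx mule_ge0 ?diam_pow_ge0//.
    by rewrite lee_fin mulr_ge0// ltW.
  have /gee0P[Uoo|[D D0 UD]] : (0 <= diam (U k))%E.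
    by apply: le_trans (diam_ge _ _ _ Uy0 Uy0); rewrite lee_fin.
    by have := U1 k; rewrite Uoo.
  exists `[y0 - C * D `^ s, y0 + C * D `^ s]; split.
    move=> y y01' Uy; rewrite /= in_itv /= -ler_distlC.
    apply: le_trans (holder _ _ y01 y01') _; rewrite ler_pM2l//.
    rewrite ge0_ler_powR ?nnegrE//.
    by rewrite -lee_fin -UD; exact: diam_ge.
  rewrite lebesgue_measure_itv /= lte_fin /diam_pow.
  have /negbTE -> : U k != set0 by apply/set0P; exists (g y0).
  rewrite UD poweR_EFin -EFinM; case: ifPn => _; last first.
    by rewrite lee_fin !mulr_ge0 ?powR_ge0// ltW.
  by rewrite -EFinB lee_fin; lra.
pose F k : set R := [set` sval (cid (fit k))].
have F1 k y : 0 <= y < 1 -> U k (g y) -> F k y.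
  by have [h _] := svalP (cid (fit k)); exact: h.
have F2 k : (lebesgue_measure (F k) <= (2 * C)%:E * diam_pow s (U k))%E.
  by have [_] := svalP (cid (fit k)).
have sub : ((1 : R)%:E <= \sum_(0 <= k <oo) (lebesgue_measure (F k) : \bar R))%E.
  have <- : lebesgue_measure (`[0, 1[%classic : set R) = 1%:E.
    by rewrite lebesgue_measure_itv /= lte_fin ltr01 oppr0 adde0.
  apply: measure_sigma_subadditive => //=; first by move=> n; exact: measurable_itv.
  move=> y /=; rewrite in_itv/= => y01.
  by have [k _ Uk] := UA _ (gA _ y01); exists k => //; exact: F1.
have {}sub : ((1 : R)%:E <= (2 * C)%:E * \sum_(0 <= k <oo) diam_pow s (U k))%E.
  rewrite -nneseriesZl; last by move=> *; exact: diam_pow_ge0.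
  apply: le_trans sub _; apply: lee_nneseries => [k _ _|k _]; last exact: F2.
  exact: measure_ge0.
have CC0 : 0 < 2 * C by rewrite mulr_gt0.
rewrite -(lee_pmul2l (x := (2 * C)%:E)) ?lte_fin//.
by rewrite -EFinM divff// gt_eqF.
Qed.

(** N intervals of length 1 / N cover the set and contribute N^(1 - s), which
    tends to 0. *)
Lemma hausdorff_measure_unit_itv A s : 1 < s -> A `<=` `[0, 1[ ->
  hausdorff_measure s A = 0%E.
Proof.
move=> s1 A01; apply/eqP; rewrite eq_le; apply/andP; split; last first.
  apply: le_trans (hausdorff_premeasure_ge0 s 1 A) _.
  by apply: ereal_sup_ubound; exists 1 => //=.
apply: ge_ereal_sup => _ [delta /= delta0 <-].
apply/lee_addgt0Pr => e e0; rewrite add0e.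
have [N [N0 [Nd Ne]]] : exists N : nat, [/\ (0 < N)%N, N%:R^-1 <= delta
    & N%:R * (N%:R^-1 `^ s) <= e].
  (* t ^ (1 - s) = e, and the power 1 - s is decreasing *)
  pose t := e `^ (1 - s)^-1; pose N := (Num.truncn (Num.max t delta^-1)).+1.
  have Nmax : Num.max t delta^-1 <= N%:R.
    by apply/ltW; rewrite /N; exact: truncnS_gt.
  have N0 : 0 < N%:R :> R by rewrite ltr0n.
  exists N; split => //.
    rewrite -[delta]invrK lef_pV2 ?posrE ?invr_gt0//.
    by apply: le_trans Nmax; rewrite le_max lexx orbT.
  rewrite -powR_inv1 ?ler0n// -powRrM mulN1r -{1}(powRr1 (ltW N0)) -powRD; last first.
    by apply/implyP => _; rewrite gt_eqF.
  have tN : t <= N%:R by apply: le_trans Nmax; rewrite le_max lexx.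
  have -> : e = t `^ (1 - s).
    by rewrite /t -powRrM mulVf ?powRr1 ?ltW// subr_eq0 lt_eqF.
  have t0 : 0 < t by rewrite powR_gt0.
  rewrite -[1 - s]opprB !powRN lef_pV2 ?posrE ?powR_gt0//.
  by rewrite ge0_ler_powR ?nnegrE ?ler0n ?(ltW t0) ?subr_ge0 ?(ltW s1).
pose V (k : nat) : set R :=
  if (k < N)%N then `[k%:R / N%:R, k.+1%:R / N%:R]%classic else set0.
have diamV k : (diam (V k) <= (N%:R^-1)%:E)%E.
  apply: ge_ereal_sup => _ [[x y] [/= Vx Vy] <-].
  move: Vx Vy; rewrite /V; case: ifP => //= _; rewrite !in_itv /= -natr1 mulrDl mul1r.
  move=> xN yN; rewrite lee_fin ler_norml; lra.
apply: ge_ereal_inf; exists (\sum_(0 <= k <oo) diam_pow s (V k))%E.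
  exists V => //; split=> [k|x /A01 /=]; first by rewrite (le_trans (diamV k))// lee_fin.
  rewrite in_itv /= => /andP[x0 x1]; exists (Num.truncn (N%:R * x)) => //.
  have /andP[h1 h2] : (Num.truncn (N%:R * x))%:R <= N%:R * x
      < (Num.truncn (N%:R * x)).+1%:R.
    by apply: truncn_itv; rewrite mulr_ge0.
  have NR0 : 0 < N%:R :> R by rewrite ltr0n.
  rewrite /V ifT; last first.
    by rewrite -(ltr_nat R) (le_lt_trans h1)// gtr_pMr.
  by rewrite /= in_itv /= ler_pdivrMr// ler_pdivlMr// (mulrC x) h1 ltW.
apply: lime_le; first by apply: is_cvg_nneseries => k _ _; exact: diam_pow_ge0.
apply: nearW => n; apply: le_trans (_ : (N%:R * (N%:R^-1 `^ s))%:E <= _)%E; last first.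
  by rewrite lee_fin.
have pow0 : 0 <= N%:R^-1 `^ s by exact: powR_ge0.
have term k : (diam_pow s (V k) <= (if (k < N)%N then N%:R^-1 `^ s else 0)%:E)%E.
  rewrite /diam_pow; case: eqP => [_|/eqP/set0P[x Vx]].
    by rewrite lee_fin; case: ifP.
  have kN : (k < N)%N by move: Vx; rewrite /V; case: ifP.
  have /gee0P[Voo|[D D0 VD]] : (0 <= diam (V k))%E.
    by apply: le_trans (diam_ge _ _ _ Vx Vx); rewrite lee_fin.
    by have := diamV k; rewrite Voo.
  rewrite kN VD poweR_EFin lee_fin ge0_ler_powR ?nnegrE ?invr_ge0//.
    by rewrite (le_trans _ (ltW s1)).
  by have := diamV k; rewrite VD lee_fin.
apply: (@le_trans _ _ (\sum_(0 <= k < n) (if (k < N)%N then N%:R^-1 `^ s else 0)%:E)%E).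
  by apply: lee_sum => k _; exact: term.
rewrite sumEFin lee_fin.
apply: (@le_trans _ _ (\sum_(0 <= k < n + N) (if (k < N)%N then N%:R^-1 `^ s else 0))).
  rewrite [leRHS](@big_cat_nat _ _ _ n)//= ?leq_addr// lerDl sumr_ge0// => k _.
  by case: ifP.
rewrite (@big_cat_nat _ _ _ N)//= ?leq_addl// [X in _ + X]big_nat_cond.
rewrite [X in _ + X]big1 ?addr0; last by move=> k /andP[/andP[Nk _] _]; rewrite ltnNge Nk.
rewrite big_nat_cond (eq_bigr (fun=> N%:R^-1 `^ s)); last by move=> k /andP[/andP[_ ->]].
by rewrite -big_nat_cond sumr_const_nat subn0 mulr_natl.
Qed.

End hausdorff_estimates.

(** * Expansions in base m *)

Section base_expansion.
Context {R : realType}.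
Implicit Types (m : nat) (y : R).

Definition base_digit m y : nat := Num.truncn (m%:R * y).

Definition base_shift m y : R := m%:R * y - (base_digit m y)%:R.

Definition base_digits m y : nat^nat := fun k => base_digit m (iter k (base_shift m) y).

Lemma base_digit_lt m y : (0 < m)%N -> 0 <= y < 1 -> (base_digit m y < m)%N.
Proof.
move=> m0 /andP[y0 y1]; rewrite -(ltr_nat R).
have /andP[h _] : (base_digit m y)%:R <= m%:R * y < (base_digit m y).+1%:R.
  by apply: truncn_itv; rewrite mulr_ge0.
by apply: le_lt_trans h _; rewrite gtr_pMr// ltr0n.
Qed.

Lemma base_shift_itv m y : 0 <= y -> 0 <= base_shift m y < 1.
Proof.
move=> y0; rewrite /base_shift.
have /andP[h1 h2] : (base_digit m y)%:R <= m%:R * y < (base_digit m y).+1%:R.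
  by apply: truncn_itv; rewrite mulr_ge0.
by rewrite subr_ge0 h1 ltrBlDr addrC natr1.
Qed.

Lemma base_digits_lt m y : (0 < m)%N -> 0 <= y < 1 ->
  forall k, (base_digits m y k < m)%N.
Proof.
move=> m0 y01 k; apply: base_digit_lt => //.
elim: k => //= k /andP[h _]; exact: base_shift_itv.
Qed.

Lemma base_digits_dist m n y y' : (0 < m)%N -> 0 <= y < 1 -> 0 <= y' < 1 ->
  (forall k, (k < n)%N -> base_digits m y k = base_digits m y' k) ->
  `|y - y'| <= m%:R^-1 ^+ n.
Proof.
move=> m0; elim: n y y' => [|n IHn] y y' y01 y'01 E.
  by rewrite expr0 ler_norml; lra.
have mm : 0 < m%:R :> R by rewrite ltr0n.
rewrite exprS ler_pdivlMl// -[m%:R in leLHS](gtr0_norm mm) -normrM mulrBr.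
have -> : m%:R * y - m%:R * y' = base_shift m y - base_shift m y'.
  by have := E 0%N isT; rewrite /base_digits /= /base_shift => ->; lra.
apply: IHn => [||k kn]; [by case/andP: y01 => ? _; exact: base_shift_itv
  |by case/andP: y'01 => ? _; exact: base_shift_itv|].
by have := E k.+1 kn; rewrite /base_digits !iterSr.
Qed.

End base_expansion.

(** * A subset of large dimension *)

Section main.
Context {R : realType}.

Definition run_dominated (lambda : nat) : set R :=
  [set x | 0 <= x < 1 /\ irrational x /\
    forall n mu : nat, (0 < n)%N -> (0 < mu)%N -> mu <> lambda ->
      (longest_run n x mu < longest_run n x lambda)%N].

(** The pigeonhole applied to the words of length n selects m words with
    |w| >= r; prefixing lambda costs the factor c = (lambda + 1)^-2 in the lower
    Lipschitz constant, hence rho = c r / 2. As the pigeonhole provides any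
    constant, this loss and one more factor 2, which forces m > 1, are absorbed
    in advance. *)
Lemma large_word_family lambda (s : R) : (0 < lambda)%N -> 0 <= s < 1 ->
  exists n M m (wd : nat -> seq nat) (rho : R),
  [/\ (1 < m)%N, 0 < rho, 1 <= m%:R * rho `^ s,
      {in [pred j | (j < m)%N] &, injective wd}
    & forall j, (j < m)%N ->
      [/\ size (wd j) = n.+1, nth 1%N (wd j) 0 = lambda,
          all (fun c => 0 < c <= M)%N (wd j)
        & forall t t' : R, 0 <= t <= 1 -> 0 <= t' <= 1 ->
          rho * `|t - t'| <= `|cf_map (wd j) t - cf_map (wd j) t'|]].
Proof.
move=> lambda0 s01; have /andP[s0 s1] := s01.
pose c : R := lambda.+1%:R^-1 ^+ 2.
have c0 : 0 < c by rewrite exprn_gt0// invr_gt0 ltr0n.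
have c1 : c <= 1 by rewrite exprn_ile1 ?invr_ge0// invf_le1 ?ltr0n// ler1n.
have c2s : 0 < (c / 2) `^ s by rewrite powR_gt0// divr_gt0.
have [|n nP] := dyadic_pigeonhole s (2 / (c / 2) `^ s) s01; first by rewrite divr_gt0.
have [M0 M0P] := words_fill (R := R) n.
have [|r [r0 rP]] := nP _ (words M0 n) (@cf_len R) _ M0P.
  move=> w wl; rewrite cf_len_gt0 ?(words_pos _ _ _ wl)//=.
  by have [<- _] := words_spec _ _ _ wl; rewrite cf_len_le// (words_pos _ _ _ wl).
pose W := [seq w <- words M0 n | r <= cf_len w]; pose m := size W.
have WP w : w \in W -> [/\ size w = n, all (fun c => 0 < c <= M0)%N w,
    all (leq 1) w & r <= cf_len w].
  rewrite mem_filter => /andP[rw wl]; have [? ?] := words_spec _ _ _ wl.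
  by split => //; exact: words_pos wl.
have Wnth j : (j < m)%N -> nth [::] W j \in W by exact: mem_nth.
pose rho := c * (r / 2).
have rho0 : 0 < rho by rewrite !mulr_gt0// divr_gt0.
have mrho : 2 <= m%:R * rho `^ s.
  move: rP; rewrite -size_filter -/W -/m ler_pdivrMr// -mulrA -powRM.
  - by rewrite /rho mulrCA.
  - exact: ltW.
  - by rewrite divr_ge0// ltW.
have m1 : (1 < m)%N.
  rewrite ltnNge; apply/negP => m1.
  have m0 : (0 < m)%N.
    by rewrite lt0n; apply/eqP => m0; move: mrho; rewrite m0 mul0r; lra.
  have [szw _ w1 rw] := WP _ (Wnth 0%N m0).
  have rho1 : rho <= 1.
    have : r <= 1.
      apply: le_trans rw (le_trans (cf_len_le _ w1) _).
      by rewrite exprn_ile1 ?invr_ge0//; lra.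
    by rewrite /rho; nra.
  have : rho `^ s <= 1 `^ s by rewrite ge0_ler_powR ?nnegrE ?(ltW rho0).
  rewrite powR1 => rhos1.
  have : m%:R <= 1 :> R by rewrite -[1]/(1%:R) ler_nat.
  have := powR_ge0 rho s; nra.
exists n, (maxn M0 lambda), m, (fun j => lambda :: nth [::] W j), rho; split => //.
- by apply: le_trans mrho; lra.
- move=> i j im jm [] /eqP; rewrite nth_uniq// ?filter_uniq ?words_uniq//.
  by move/eqP.
- move=> j /Wnth/WP[szw wM w1 rw]; split => //=.
  + by rewrite szw.
  + rewrite lambda0 leq_maxr /=; apply: sub_all wM => b /andP[-> bM] /=.
    by rewrite leq_max bM.
  + move=> t t' t01 t'01.
    have := cf_map_dist_ge_letters lambda [:: lambda] (cf_map (nth [::] W j) t)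
      (cf_map (nth [::] W j) t').
    rewrite /= lambda0 leqnn expr1 => /(_ isT).
    move=> /(_ (cf_map_itv _ _ w1 t01) (cf_map_itv _ _ w1 t'01)).
    apply: le_trans; rewrite /rho -mulrA ler_wpM2l ?(ltW c0)//.
    apply: le_trans (cf_map_dist_ge _ _ _ w1 t01 t'01).
    by rewrite ler_wpM2r// ler_pM2r.
Qed.

(** The base m digits of y number the blocks which follow lambda^K in the
    expansion of [g y]. *)
Lemma run_dominated_hausdorff_measure lambda (s : R) : (0 < lambda)%N -> 0 <= s < 1 ->
  hausdorff_measure s (run_dominated lambda) != 0%E.
Proof.
move=> lambda0 s01; have /andP[s0 _] := s01.
have [n [M [m [wd [rho [m1 rho0 mrho inj wdP]]]]]] := large_word_family _ _ lambda0 s01.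
pose K := n.+1; have m0 := ltnW m1.
pose b (y : R) := blocks K wd (base_digits m y).
pose g (y : R) : R := cf (prepend K lambda (b y)).
have blocksM d : (forall i, d i < m)%N -> forall i, (0 < blocks K wd d i <= M)%N.
  move=> dm i; have [szw _ /allP wM _] := wdP _ (dm (i %/ K)%N).
  by apply/wM/mem_nth; rewrite szw ltn_pmod.
have bM y : 0 <= y < 1 -> forall i, (0 < b y i <= M)%N.
  by move=> y01; apply: blocksM; exact: base_digits_lt.
have b0 y : 0 <= y < 1 -> digits_gt0 (b y).
  by move=> y01 i; have /andP[] := bM y y01 i.
have pb0 y : 0 <= y < 1 -> digits_gt0 (prepend K lambda (b y)).
  by move=> y01 i; rewrite /prepend; case: ifP => // _; exact: b0.
pose gap : R := M.+1%:R^-1 ^+ (3 * K).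
have gap0 : 0 < gap by rewrite exprn_gt0// invr_gt0 ltr0n.
have sep := cf_blocks_sep K m wd rho gap isT (ltW rho0).
pose pre : R := (lambda.+1%:R^-1 ^+ 2) ^+ K.
have pre0 : 0 < pre by rewrite !exprn_gt0// invr_gt0 ltr0n.
pose C := (pre * gap)^-1 `^ s.
have C0 : 0 < C by rewrite powR_gt0// invr_gt0 mulr_gt0.
apply: (hausdorff_measure_neq0_of_holder _ g s C s0 C0) => [y y01|y y' y01 y'01].
  have a0 := pb0 y y01; have /andP[g0 g1] := cf_gt0_lt1 (R := R) _ a0.
  split; [by rewrite g1 ltW|split; first exact: cf_irrational].
  move=> k mu k0 _ mul; apply: (longest_run_lt K) => // i.
  rewrite /prepend; case: ltnP => //= Ki Kdvd.
  have [|szw hd _ _] := wdP (base_digits m y ((i - K) %/ K)%N).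
    exact: base_digits_lt.
  have iK0 : ((i - K) %% K = 0)%N by apply/eqP; rewrite -/(dvdn K _) dvdn_subl.
  by rewrite /b /blocks iK0 hd.
have [->|yy'] := eqVneq y y'; first by rewrite subrr normr0 mulr_ge0 ?powR_ge0// ltW.
have mR0 : 0 < m%:R :> R by rewrite ltr0n.
have exk : exists k, base_digits m y k != base_digits m y' k.
  apply: contrapT => nok.
  have [||k] := expr_small (m%:R^-1) `|y - y'|.
  - by rewrite invr_ge0 ler0n invf_lt1// ltr1n.
  - by rewrite normr_gt0 subr_eq0.
  rewrite ltNge base_digits_dist// => i _; apply/eqP; apply: contrapT => di.
  by apply: nok; exists i; apply/negP.
case: (ex_minnP exk) => k /eqP dk kmin.
have agree i : (i < k)%N -> base_digits m y i = base_digits m y' i.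
  by move=> ik; apply/eqP; apply: contraTT ik => /kmin; rewrite -leqNgt.
apply: le_trans (base_digits_dist _ _ _ _ m0 y01 y'01 agree) _.
apply: (@le_trans _ _ ((rho ^+ k) `^ s)).
  rewrite powRX ?(ltW rho0)//; apply: lerXn2r; rewrite ?nnegrE ?invr_ge0 ?powR_ge0//.
  by rewrite -[_^-1]mulr1 ler_pdivrMl.
rewrite /C -powRM ?invr_ge0 ?mulr_ge0 ?(ltW pre0) ?(ltW gap0)//.
have pregap0 := mulr_gt0 pre0 gap0.
rewrite ge0_ler_powR ?nnegrE ?exprn_ge0 ?(ltW rho0)//.
  by rewrite mulr_ge0 ?invr_ge0 ?(ltW pregap0).
rewrite ler_pdivlMl// /g !cf_prepend//; [|exact: b0|exact: b0].
have letters : all (fun c => 0 < c <= lambda)%N (nseq K lambda).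
  by rewrite all_nseq lambda0 leqnn orbT.
have := cf_map_dist_ge_letters lambda _ _ _ letters
  (cf_itv (R := R) _ (b0 y y01)) (cf_itv (R := R) _ (b0 y' y'01)).
rewrite size_nseq -/pre; apply: le_trans.
rewrite -mulrA ler_wpM2l ?(ltW pre0)// mulrC; apply: sep => //.
- by move=> j /wdP[szw hd wM _]; split => //; apply: sub_all wM => ? /andP[].
- by move=> j t t' /wdP[_ _ _]; exact.
- move=> d d' dm d'm d0; apply: cf_gap; [exact: blocksM|exact: blocksM|].
  rewrite !blocks_head; [|by have [] := wdP _ (d'm 0%N)|by have [] := wdP _ (dm 0%N)].
  by move/inj; rewrite !inE => /(_ (dm _) (d'm _)).
- exact: base_digits_lt.
- exact: base_digits_lt.
Qed.

End main.

Theorem corollary3 (R : realType) (lambda : nat) (lambda_gt0 : (0 < lambda)%N) :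
  hausdorff_dim
    [set x : R | 0 <= x < 1 /\ irrational x /\
      forall n mu : nat, (0 < n)%N -> (0 < mu)%N -> mu <> lambda ->
        (longest_run n x mu < longest_run n x lambda)%N] = 1%:E.
Proof.
rewrite -/(run_dominated lambda); apply/eqP; rewrite eq_le; apply/andP; split.
  apply/lee_addgt0Pr => e e0; apply: ereal_inf_lbound; exists (1 + e) => //=.
  split; first by lra.
  apply: hausdorff_measure_unit_itv; first by lra.
  by move=> x [x01 _]; rewrite /= in_itv.
apply: le_ereal_inf_tmp => _ [s [s0 Hs] <-]; rewrite lee_fin leNgt.
apply/negP => s1.
have s01 : 0 <= s < 1 by rewrite s0.
by have := run_dominated_hausdorff_measure lambda s lambda_gt0 s01; rewrite Hs eqxx.
Qed.
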